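(* Let $\phi(t)=(q(t),p(t))$ be a bound Kepler orbit with energy $H<0$, eccentricity $0\le e<1$ and periapsis at $t=0$, with eccentric anomaly $\varepsilon(t)$ and mean anomaly $M(t)$. Write $S(\phi(t))=[(r_0,\vec r),(s_0,\vec s),\sqrt{-2H}]$. Then the rotation angle $-s_0$ of the map $R$ at the point $S(\phi(t))$ equals $\varepsilon(t)-M(t)$; that is, $-s_0(t)=\varepsilon(t)-M(t)$ for all $t$.
   Context: The Kepler Hamiltonian is $H(q,p)=\frac12|p|^2-|q|^{-1}$ on $\{(q,p)\in\mathbb R^3\times\mathbb R^3: q\ne0\}$; a Kepler orbit is a solution of $\dot q=p$, $\dot p=-q/|q|^3$. Let $\Sigma_-=\{(q,p): q\neq 0,\ H(q,p)<0\}$ and $T_1^*S^3=\{(x,y)\in\mathbb R^4\times\mathbb R^4: |x|=|y|=1,\ \langle x,y\rangle=0\}$. Define $S:\Sigma_-\to T_1^*S^3\times\mathbb R_{>0}$ by $S(q,p)=[(r_0,\vec r),(s_0,\vec s),\sqrt{-2H}]$, where $$r_0=|p|^2|q|-1,\quad \vec r=\sqrt{-2H}\,|q|\,p,\quad s_0=-\sqrt{-2H}\,\langle q,p\rangle,\quad \vec s=-\Big(\frac{q}{|q|}-\langle q,p\rangle p\Big).$$ The map $R$ sends $(r,s,\sqrt{-2H})$ (the last entry being the $\mathbb R_{>0}$-component) to $(x,y)$ given by $$\begin{pmatrix}x_0&\vec x\\ y_0&\vec y\end{pmatrix}=\begin{pmatrix}\cos(-s_0)&-\sin(-s_0)\\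 \frac{\sin(-s_0)}{\sqrt{-2H}}&\frac{\cos(-s_0)}{\sqrt{-2H}}\end{pmatrix}\begin{pmatrix}r_0&\vec r\\ s_0&\vec s\end{pmatrix},$$ i.e. a rotation by the angle $-s_0$ followed by scaling the second row by $1/\sqrt{-2H}$. For a bound orbit with semi-major axis $a=-\frac1{2H}$, eccentricity $e$ and periapsis at $t=0$, the eccentric anomaly $\varepsilon(t)$ (continuous, $\varepsilon(0)=0$) and mean anomaly $M(t)$ satisfy $|q(t)|=a(1-e\cos\varepsilon(t))$ and $M(t)=\varepsilon(t)-e\sin\varepsilon(t)=a^{-3/2}t$. *)

(* Defs.v *)
From HB Require Import structures.
From mathcomp Require Import all_boot all_order all_algebra.
From mathcomp Require Import all_classical all_reals all_analysis.
Import Order.TTheory GRing.Theory Num.Theory numFieldNormedType.Exports.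

Set Implicit Arguments.
Unset Strict Implicit.
Unset Printing Implicit Defensive.

Local Open Scope classical_set_scope.
Local Open Scope ring_scope.

Definition dot (R : realType) (n : nat) (u v : 'rV[R]_n) : R :=
  \sum_(i < n) u 0 i * v 0 i.

(* The Euclidean norm; the library's `|u| on row vectors is the sup norm. *)
Definition enorm (R : realType) (n : nat) (u : 'rV[R]_n) : R :=
  Num.sqrt (dot u u).

Section Kepler.
Variable R : realType.
Implicit Types q p : 'rV[R]_3.

Definition hamiltonian q p : R := 2^-1 * enorm p ^+ 2 - (enorm q)^-1.

Definition Sigma_minus : set ('rV[R]_3 * 'rV[R]_3) :=
  [set z | z.1 != 0 /\ hamiltonian z.1 z.2 < 0].

(* The topology on 'rV[R]_3 induced by the sup norm is the Euclidean one, so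
   these are the usual derivatives. *)
Definition kepler_orbit (q p : R -> 'rV[R]_3) : Prop :=
  forall t : R,
    [/\ q t != 0,
        is_derive t (1 : R) q (p t) &
        is_derive t (1 : R) p (- ((enorm (q t) ^+ 3)^-1 *: q t))].

Definition semi_major_axis q p : R := - (2 * hamiltonian q p)^-1.

(* The Laplace-Runge-Lenz vector p x (q x p) - q / |q|, with the double cross
   product expanded as |p|^2 q - <q, p> p. *)
Definition eccentricity_vector q p : 'rV[R]_3 :=
  enorm p ^+ 2 *: q - dot q p *: p - (enorm q)^-1 *: q.

Definition eccentricity q p : R := enorm (eccentricity_vector q p).

Definition periapsis_at (q : R -> 'rV[R]_3) (t0 : R) : Prop :=
  forall t : R, enorm (q t0) <= enorm (q t).

(* eps and M are the eccentric and mean anomalies of an orbit with position q,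
   semi-major axis a, eccentricity e and periapsis at time 0.  Kepler's equation
   together with the law of M determines both functions uniquely, also for
   circular orbits, where the equation for the radius says nothing about eps. *)
Record anomalies (q : R -> 'rV[R]_3) (a e : R) (eps M : R -> R) : Prop :=
  Anomalies {
    eccentric_anomaly_continuous : continuous eps;
    eccentric_anomaly0 : eps 0 = 0;
    eccentric_anomaly_radius :
      forall t : R, enorm (q t) = a * (1 - e * cos (eps t));
    kepler_equation : forall t : R, M t = eps t - e * sin (eps t);
    mean_anomaly_linear : forall t : R, M t = a `^ (- (3 / 2)) * t
  }.

(* A vector (x_0, vec x) of R^4 is row_mx x_0%:M (vec x), of type 'rV_(1 + 3).
   S is total; it is meaningful on Sigma_minus. *)
Definition S_map (z : 'rV[R]_3 * 'rV[R]_3) :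
    'rV[R]_(1 + 3) * 'rV[R]_(1 + 3) * R :=
  let: (q, p) := z in
  let nu := Num.sqrt (- (2 * hamiltonian q p)) in
  let r0 := enorm p ^+ 2 * enorm q - 1 in
  let rv := (nu * enorm q) *: p in
  let s0 := - (nu * dot q p) in
  let sv := - ((enorm q)^-1 *: q - dot q p *: p) in
  (row_mx r0%:M rv, row_mx s0%:M sv, nu).

Definition R_angle (w : 'rV[R]_(1 + 3) * 'rV[R]_(1 + 3) * R) : R :=
  let: (_, s, _) := w in - s 0 0.

(* The matrix of R: rotation by theta, then division of the second row by nu. *)
Definition R_matrix (theta nu : R) : 'M[R]_(1 + 1) :=
  block_mx (cos theta)%:M (- sin theta)%:M
           (sin theta / nu)%:M (cos theta / nu)%:M.

Definition R_map (w : 'rV[R]_(1 + 3) * 'rV[R]_(1 + 3) * R) :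
    'rV[R]_(1 + 3) * 'rV[R]_(1 + 3) :=
  let: (r, s, nu) := w in
  let xy := R_matrix (R_angle w) nu *m col_mx r s in
  (usubmx xy, dsubmx xy).

End Kepler.

(* Main.v *)
(* Kepler's equation gives [eps - M = e sin eps], so the claim is
   [nu <q, p> = e sin eps].  Along the orbit [<q, p> = |q| |q|'], and
   [|q| = a (1 - e cos eps)] gives [|q|' = a e sin eps * eps'].  The derivative
   of [eps] comes from Kepler's equation by the inverse function theorem, since
   [x - e sin x] has positive derivative for [e < 1].  Conservation of energy
   makes [nu] the constant [a ^ (-1/2)], and the powers of [a] cancel. *)
Require Import Defs.
From HB Require Import structures.
From mathcomp Require Import all_boot all_order all_algebra.
From mathcomp Require Import all_classical all_reals all_analysis.
From mathcomp Require Import ring.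
Import Order.TTheory GRing.Theory Num.Theory numFieldNormedType.Exports.
Local Open Scope classical_set_scope.
Local Open Scope ring_scope.

Section Euclidean.
Set Implicit Arguments.
Unset Strict Implicit.
Context {R : realType} {n : nat}.
Implicit Types u v : 'rV[R]_n.

Lemma dotC u v : dot u v = dot v u.
Proof. by apply: eq_bigr => i _; rewrite mulrC. Qed.

Lemma dotZr (c : R) u v : dot u (c *: v) = c * dot u v.
Proof. by rewrite /dot mulr_sumr; apply: eq_bigr => i _; rewrite mxE mulrCA. Qed.

Lemma dotNr u v : dot u (- v) = - dot u v.
Proof. by rewrite /dot -sumrN; apply: eq_bigr => i _; rewrite mxE mulrN. Qed.

Lemma dot_ge0 u : 0 <= dot u u.
Proof. by apply: sumr_ge0 => i _; rewrite -expr2 sqr_ge0. Qed.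

Lemma dot_gt0 u : u != 0 -> 0 < dot u u.
Proof.
move=> u0; rewrite lt_def dot_ge0 andbT; apply: contra u0 => /eqP uu0.
apply/eqP/rowP => i; rewrite mxE; apply/eqP; rewrite -sqrf_eq0 expr2.
apply/eqP/(psumr_eq0P _ uu0) => // j _.
by rewrite -expr2 sqr_ge0.
Qed.

Lemma enorm_gt0 u : u != 0 -> 0 < enorm u.
Proof. by move=> u0; rewrite sqrtr_gt0 dot_gt0. Qed.

Lemma sqr_enorm u : enorm u ^+ 2 = dot u u.
Proof. by rewrite sqr_sqrtr ?dot_ge0. Qed.

Lemma is_derive_row_coord (u : R -> 'rV[R]_n) u' (t : R) i :
  is_derive t (1 : R) u u' -> is_derive t (1 : R) (fun x => u x 0 i) (u' 0 i).
Proof.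
move=> du; have du' : derivable u t 1 by [].
apply: DeriveDef; first by have /derivable_mxP := du'; apply.
by rewrite -(@derive_val _ _ _ _ _ _ _ du) derive_mx // mxE.
Qed.

Lemma is_derive_dot (u v : R -> 'rV[R]_n) u' v' (t : R) :
  is_derive t (1 : R) u u' -> is_derive t (1 : R) v v' ->
  is_derive t (1 : R) (fun x => dot (u x) (v x)) (dot (u t) v' + dot (v t) u').
Proof.
move=> du dv.
have -> : (fun x => dot (u x) (v x)) =
    \sum_(i < n) ((fun x => u x 0 i) * (fun x => v x 0 i)).
  by apply/funext => x; rewrite /dot fct_sumE.
rewrite /dot -big_split /=; apply: is_derive_sum => i.
by apply: is_deriveM; exact: is_derive_row_coord.
Qed.

(** The square root is differentiable only away from 0, hence the condition on [u t]. *)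
Lemma is_derive_enorm (u : R -> 'rV[R]_n) u' (t : R) : u t != 0 ->
  is_derive t (1 : R) u u' ->
  is_derive t (1 : R) (fun x => enorm (u x)) (dot (u t) u' / enorm (u t)).
Proof.
move=> ut0 du; have un0 := lt0r_neq0 (enorm_gt0 ut0).
apply: (is_derive_eq (is_derive1_comp (f := Num.sqrt)
  (is_derive1_sqrt (dot_gt0 ut0)) (is_derive_dot du du))).
by rewrite -/(enorm _); field.
Qed.

End Euclidean.

Section KeplerMotion.
Set Implicit Arguments.
Unset Strict Implicit.
Context {R : realType}.

(** The kinetic term has derivative [- dot q p / enorm q ^+ 3] by the force law, which the
    derivative of the potential term cancels; a function with zero derivative is constant. *)
Lemma kepler_energy_conserved (q p : R -> 'rV[R]_3) (s t : R) :
  kepler_orbit q p -> hamiltonian (q s) (p s) = hamiltonian (q t) (p t).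
Proof.
move=> orb; apply: (@is_derive_0_is_cst R (fun x => hamiltonian (q x) (p x))).
move=> x; have [qx0 dq dp] := orb x; have nq0 := lt0r_neq0 (enorm_gt0 qx0).
have -> : (fun x => hamiltonian (q x) (p x)) =
    2^-1 \*: (fun x => dot (p x) (p x)) - (fun x => (enorm (q x))^-1).
  by apply/funext => y; rewrite /hamiltonian sqr_enorm.
apply: is_derive_eq.
  apply: is_deriveB; first by apply: is_deriveZ; exact: is_derive_dot.
  by apply: is_deriveV => //; exact: is_derive_enorm.
rewrite dotNr dotZr (dotC (p x)) /GRing.scale /=.
by field.
Qed.

(** The factor [c] serves two uses: [c = 1] for injectivity, and the inverse of the mean motion when
    time is written as a function of the eccentric anomaly. *)
Lemma is_derive_kepler_equation (c e x : R) :
  is_derive x (1 : R) (fun x => c * (x - e * sin x)) (c * (1 - e * cos x)).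
Proof.
have -> : (fun x : R => c * (x - e * sin x)) = c \*: (id - e \*: sin) by [].
by apply: is_derive_eq.
Qed.

Lemma kepler_equation_rate_gt0 (e x : R) : 0 <= e < 1 -> 0 < 1 - e * cos x.
Proof.
move=> /andP[e0 e1]; rewrite subr_gt0; apply: le_lt_trans e1.
by rewrite ler_piMr // cos_le1.
Qed.

(** If two distinct points had equal values, the mean value theorem would give a zero of the
    positive derivative [1 - e * cos z] between them. *)
Lemma kepler_equation_inj (e : R) : 0 <= e < 1 ->
  injective (fun x => x - e * sin x).
Proof.
move=> he; have neq x y : x < y -> x - e * sin x <> y - e * sin y.
  move=> xy eqxy.
  have d z := is_derive_kepler_equation 1 e z.
  have [|z _ /eqP] := MVT xy (fun z _ => d z).
    by apply: derivable_within_continuous => z _; exact: ex_derive.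
  rewrite !mul1r eqxy subrr eq_sym mulf_eq0 (subr_eq0 y) (gt_eqF xy) orbF.
  by rewrite gt_eqF ?kepler_equation_rate_gt0.
move=> x y eqxy; have [/neq//|/neq []|//] := ltgtP x y.
exact: esym.
Qed.

(** Here [k] is the mean motion. The function [f] gives the time at which a given eccentric anomaly
    is reached, so [eps] is its inverse and has the reciprocal derivative. *)
Lemma is_derive_eccentric_anomaly (k e : R) (eps : R -> R) (t : R) :
  0 <= e < 1 -> k != 0 -> (forall t, eps t - e * sin (eps t) = k * t) ->
  is_derive t (1 : R) eps (k / (1 - e * cos (eps t))).
Proof.
move=> he k0 kepler; set f := fun x => k^-1 * (x - e * sin x).
have fK : cancel f eps.
  (* Kepler's equation at time [f x] says that [eps (f x)] and [x] have the same mean anomaly, so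
     injectivity identifies them. *)
  by move=> x; apply: (kepler_equation_inj he); rewrite kepler mulVKf.
have epsK : f (eps t) = t by rewrite /f kepler mulKf.
have rate0 := lt0r_neq0 (kepler_equation_rate_gt0 (eps t) he).
have -> : k / (1 - e * cos (eps t)) = (k^-1 * (1 - e * cos (eps t)))^-1.
  by rewrite invfM invrK.
(* The inverse function theorem differentiates at an image point, so [t] is written as
   [f (eps t)]. *)
rewrite -{1}epsK; apply: (is_derive_inverse (f := f)).
- by near=> x; exact: fK.
- near=> x; apply/differentiable_continuous/derivable1_diffP.
  exact: (@ex_derive _ _ _ _ _ _ _ (is_derive_kepler_equation k^-1 e x)).
- by rewrite mulf_neq0 ?invr_eq0.
Unshelve. all: by end_near. Qed.

End KeplerMotion.

Theorem theorem4p9 (R : realType) (q p : R -> 'rV[R]_3) (e : R)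
    (eps M : R -> R)
    (horbit : kepler_orbit q p)
    (hbound : Sigma_minus (q 0, p 0))
    (hecc : e = eccentricity (q 0) (p 0))
    (he : 0 <= e < 1)
    (hperi : periapsis_at q 0)
    (hanom : anomalies q (semi_major_axis (q 0) (p 0)) e eps M) :
  forall t : R, R_angle (S_map (q t, p t)) = eps t - M t.
Proof.
move=> t; have [_ _ radius kepler linear] := hanom.
have [_ /= H0] := hbound; have [qt0 dq _] := horbit t.
have angleE (x : R) (v : 'rV[R]_3) : row_mx x%:M v 0 0 = x.
  by rewrite mxE; case: splitP => //= j _; rewrite ord1 mxE eqxx.
rewrite /R_angle /S_map angleE opprK kepler subKr.
(* The goal is now [nu * dot q p = e * sin eps] with [nu] taken at time [t]; moving the energy to
   time 0 ties [nu] to the semi-major axis. *)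
rewrite (kepler_energy_conserved t 0 horbit).
set nu := Num.sqrt _.
have nu_gt0 : 0 < nu by rewrite sqrtr_gt0 oppr_gt0 pmulr_rlt0.
have nu0 := lt0r_neq0 nu_gt0.
have aE : semi_major_axis (q 0) (p 0) = (nu ^+ 2)^-1.
  by rewrite sqr_sqrtr ?invrN // oppr_ge0 pmulr_rle0 // ltW.
(* The mean motion: since [a] is [nu ^- 2], its power [- 3 / 2] is [nu ^+ 3]. *)
have rateE : (nu ^+ 2)^-1 `^ (- (3 / 2)) = nu ^+ 3.
  rewrite -powR_invn ?ltW // -powRrM -powR_mulrn ?ltW //.
  by congr (_ `^ _); field.
have keplert s : eps s - e * sin (eps s) = nu ^+ 3 * s.
  by rewrite -kepler linear aE rateE.
have deps := is_derive_eccentric_anomaly t he (expf_neq0 3 nu0) keplert.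
have rate0 := lt0r_neq0 (kepler_equation_rate_gt0 (eps t) he).
have dnorm := is_derive_enorm qt0 dq.
have normE : (fun s => enorm (q s)) =
    (nu ^+ 2)^-1 \*: (cst 1 - e \*: (cos \o eps)).
  by apply/funext => s; rewrite radius aE.
have dnorm' : is_derive t (1 : R) (fun s => enorm (q s))
    ((nu ^+ 2)^-1 * (e * sin (eps t)) * (nu ^+ 3 / (1 - e * cos (eps t)))).
  rewrite normE; apply: is_derive_eq; rewrite /GRing.scale /=; ring.
have nq0 := lt0r_neq0 (enorm_gt0 qt0).
(* Two expressions for the derivative of the radius agree by uniqueness of derivatives; solving for
   [dot (q t) (p t)] multiplies by [enorm (q t)]. *)
have /(canRL (divfK nq0)) -> : dot (q t) (p t) / enorm (q t) =
    (nu ^+ 2)^-1 * (e * sin (eps t)) * (nu ^+ 3 / (1 - e * cos (eps t))).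
  by rewrite -(@derive_val _ _ _ _ _ _ _ dnorm) -(@derive_val _ _ _ _ _ _ _ dnorm').
(* The radius cancels the denominator [1 - e * cos (eps t)], and the exponents of [nu] add up to 1 -
   2 + 3 - 2 = 0. *)
by rewrite radius aE; field; rewrite nu0.
Qed.
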